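(* Let $k, m\ge 1$ be integers. There exists a routing strategy for the directed graph $\mathcal{B}_{absolute}(k,m)$ in which routes take $2m-1$ hops in the worst-case. The average is at most $1.5m$ hops.
   Context: The $n$ nodes lie on a ring and are labeled $0,1,\dots,n-1$ according to their order on the ring; $x \bmod n$ always denotes an element of $[0,n-1]$, even when $x$ is negative or greater than $n-1$. Graph $\mathcal{B}_{absolute}(k,m)$ (defined for integers $k,m\ge 1$): it has $n=(2k+1)^m m$ nodes. For a node $u$ let $\ell(u)=(m-1)-(u\bmod m)$. Each node has $2k+2$ out-going links: node $u$ makes $2k+1$ links with the nodes $(u+x)\bmod n$, where $x\in\{1+i m(2k+1)^{\ell(u)} : i\in[-k,+k]\}$ ($i$ an integer), and node $u$ also makes an out-going link with node $(u+x)\bmod n$, where $x=-m+1$. A routing strategy specifies how a message travels from a source node to a target node along directed links of the graph (it need not be greedy); the number of hops of a route is the number of links traversed. *)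

(* Defs.v *)
From mathcomp Require Import all_boot all_order all_algebra.

Set Implicit Arguments.
Unset Strict Implicit.
Unset Printing Implicit Defensive.

Import Order.TTheory GRing.Theory Num.Theory.
Local Open Scope ring_scope.

(* [r s t] lists the nodes visited after [s] by a message sent from [s] to [t],
   so its size is the number of links traversed. *)
Definition routing_strategy (T : eqType) (e : rel T)
    (r : T -> T -> seq T) : Prop :=
  forall s t : T, path e s (r s t) /\ last s (r s t) = t.

Definition hops (T : Type) (r : T -> T -> seq T) (s t : T) : nat :=
  size (r s t).

Definition worst_case_hops (T : finType) (r : T -> T -> seq T) : nat :=
  \max_(s : T) \max_(t : T) hops r s t.

(* The source and the target are uniform and independent. *)
Definition average_hops (T : finType) (r : T -> T -> seq T) : rat :=
  (\sum_(s : T) \sum_(t : T) (hops r s t)%:R) / (#|T| ^ 2)%:R.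

Definition babs_order (k m : nat) : nat := ((2 * k + 1) ^ m * m)%N.

Definition babs_level (m u : nat) : nat := (m - 1 - u %% m)%N.

Definition centered_range (k : nat) : seq int :=
  [seq j%:Z - k%:Z | j <- iota 0 (2 * k + 1)].

(* The 2k+2 offsets of the out-going links of [u], with multiplicity: if
   [k > 0] and [babs_level m u = 0], the offset 1 - m occurs twice. *)
Definition babs_offsets (k m u : nat) : seq int :=
  rcons [seq 1 + i * (m * (2 * k + 1) ^ babs_level m u)%:Z
        | i <- centered_range k]
    (- m%:Z + 1).

Definition babs_link (k m : nat) : rel 'I_(babs_order k m) :=
  [rel u v : 'I_(babs_order k m) |
    has (fun x : int => v%:Z == ((u%:Z + x) %% (babs_order k m)%:Z)%Z)
        (babs_offsets k m u)].

(* Main.v *)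
(* Every link of [u] leads to the residue class of [u + 1] modulo m, and the 2k+1
   regular links of [u] add an arbitrary digit of [-k, k] at position [babs_level m u]
   of the balanced base-(2k+1) expansion of the quotient by m.  Any m consecutive hops
   meet every level once, so they can correct the quotient at will while preserving the
   residue.  Hence d + m hops always suffice, with d = (t - s) mod m: first d hops
   with digit 0 to reach the residue of t, then m hops to fix the quotient.  Since
   d(s, t) + d(t, s) <= m, the average of d is at most m / 2. *)
Require Import Defs.
From mathcomp Require Import all_boot all_order all_algebra.
From mathcomp Require Import zify ring lra.

Set Implicit Arguments.
Unset Strict Implicit.
Unset Printing Implicit Defensive.

Import Order.TTheory GRing.Theory Num.Theory.
Local Open Scope ring_scope.

Lemma mem_centered_range (k : nat) (x : int) :
  (x \in centered_range k) = (- k%:Z <= x <= k%:Z).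
Proof.
apply/mapP/idP => [[j + ->]|hx]; first by rewrite mem_iota; lia.
by exists (absz (x + k%:Z)%R); rewrite ?mem_iota; lia.
Qed.

(** Induction on the number of digits: the remainder of [x + k] modulo [2 * k + 1], shifted back by
    [k], is a lowest digit in the allowed range, and the quotient supplies the higher digits. *)
Lemma balanced_expansion (k m : nat) (x : int) :
  exists c : nat -> int, (forall l, c l \in centered_range k) /\
    (((2 * k + 1) ^ m)%:Z %|
       x - \sum_(l < m) c l * ((2 * k + 1) ^ l)%:Z)%Z.
Proof.
elim: m x => [|m IHm] x.
  by exists (fun=> 0); split=> [l|]; rewrite ?mem_centered_range ?dvd1z //; lia.
set b := (2 * k + 1)%N in IHm *.
have b_gt0 : 0 < b%:Z by rewrite /b; lia.
have [c [hc /dvdzP[y hy]]] := IHm ((x + k%:Z) %/ b%:Z)%Z.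
pose c0 := ((x + k%:Z) %% b%:Z)%Z - k%:Z.
exists (fun l => if l is l'.+1 then c l' else c0); split=> [[|l] //|].
  have := modz_ge0 (x + k%:Z) (lt0r_neq0 b_gt0).
  have := ltz_pmod (x + k%:Z) b_gt0.
  by rewrite mem_centered_range /c0 /b; lia.
apply/dvdzP; exists y; rewrite big_ord_recl /= expn0 mulr1.
under eq_bigr do rewrite /bump add1n expnS PoszM mulrCA.
rewrite -mulr_sumr expnS PoszM [y * _]mulrCA -hy /c0.
rewrite -{1}[x](addrK k%:Z) {1}(divz_eq (x + k%:Z) b%:Z); ring.
Qed.

(** Sliding the window by one drops the residue of [s] and gains that of [s + m], which is the
    same. *)
Lemma sum_modn_window (f : nat -> int) (m s : nat) : (0 < m)%N ->
  \sum_(j < m) f ((s + j) %% m)%N = \sum_(j < m) f j.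
Proof.
case: m => // m _; elim: s => [|s IHs].
  by apply: eq_bigr => j _; rewrite add0n modn_small.
rewrite -IHs big_ord_recr [RHS]big_ord_recl /= addrC.
congr (_ + _); first by rewrite addn0 addSnnS modnDr.
by apply: eq_bigr => j _; rewrite /bump add1n addSnnS.
Qed.

Lemma sum_babs_level (f : nat -> int) (m s : nat) : (0 < m)%N ->
  \sum_(j < m) f (babs_level m (s + j)) = \sum_(l < m) f l.
Proof.
move=> m_gt0; rewrite (sum_modn_window (fun r => f (m - 1 - r)%N)) //.
rewrite [RHS](reindex_inj rev_ord_inj) /=.
by apply: eq_bigr => j _; congr f; lia.
Qed.

Lemma babs_link_digit (k m : nat) (u : 'I_(babs_order k m)) (i : int) :
  i \in centered_range k ->
  exists2 v : 'I_(babs_order k m), babs_link u v &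
    ((babs_order k m)%:Z %|
       v%:Z - (u%:Z + (1 + i * (m * (2 * k + 1) ^ babs_level m u)%:Z)))%Z.
Proof.
move=> hi; set x := 1 + _; set n := babs_order k m.
have n_gt0 : 0 < n%:Z by have := ltn_ord u; rewrite -/n; lia.
have y_ge0 := modz_ge0 (u%:Z + x) (lt0r_neq0 n_gt0).
have y_ltn : (absz ((u%:Z + x) %% n%:Z)%Z < n)%N.
  by have := ltz_pmod (u%:Z + x) n_gt0; lia.
have vE : (Ordinal y_ltn)%:Z = ((u%:Z + x) %% n%:Z)%Z by rewrite /= gez0_abs.
exists (Ordinal y_ltn).
  apply/hasP; exists x; last by rewrite vE.
  by rewrite mem_rcons inE; apply/orP; right; apply/mapP; exists i.
by rewrite vE -eqz_mod_dvd modz_mod.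
Qed.

(** The digits are indexed by level, not by hop, so that a walk of [m] hops from any start uses each
    of [c 0], ..., [c (m - 1)] once. *)
Lemma babs_walk (k m : nat) (c : nat -> int) (L : nat) (s : 'I_(babs_order k m)) :
  (forall l, c l \in centered_range k) ->
  exists p, [/\ path (@babs_link k m) s p, size p = L &
    ((babs_order k m)%:Z %| (last s p)%:Z - (s%:Z + L%:Z + m%:Z *
       \sum_(j < L) c (babs_level m (s + j)) *
          ((2 * k + 1) ^ babs_level m (s + j))%:Z))%Z].
Proof.
move=> hc; elim: L => [|L [p [pP pL /dvdzP[y hy]]]].
  by exists [::]; split; rewrite // big_ord0 mulr0 !addr0 subrr dvdz0.
set u := last s p in hy.
have nE : (babs_order k m)%:Z = ((2 * k + 1) ^ m)%:Z * m%:Z by rewrite -PoszM.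
(* Every offset used is 1 modulo [m], and [m] divides the order, so wrapping around the ring does
   not disturb the residue on which the level depends. *)
have lev_u : babs_level m u = babs_level m (s + L).
  congr (_ - _)%N; apply/eqP; rewrite -eqz_nat -!modz_nat eqz_mod_dvd PoszD.
  apply/dvdzP; set S := \sum_(j < L) _ in hy.
  exists (S + y * ((2 * k + 1) ^ m)%:Z).
  rewrite nE in hy; rewrite mulrDl -mulrA -hy; ring.
have [v uv /dvdzP[z hz]] := babs_link_digit u (hc (babs_level m u)).
exists (rcons p v); split; first by rewrite rcons_path pP.
  by rewrite size_rcons pL.
apply/dvdzP; exists (y + z); rewrite last_rcons big_ord_recr /= mulrDl -hy -hz.
rewrite lev_u PoszM -addn1 PoszD; ring.
Qed.

(** Adding the order, a multiple of [m], keeps the natural subtraction from truncating, so the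
    remainder is that of t - s. *)
Definition babs_route_length (k m s t : nat) : nat :=
  ((t + (babs_order k m - s)) %% m + m)%N.

Lemma babs_route (k m : nat) (s t : 'I_(babs_order k m)) : (0 < m)%N ->
  exists p, [&& path (@babs_link k m) s p, last s p == t
    & size p == babs_route_length k m s t].
Proof.
move=> m_gt0; set e := (t + (babs_order k m - s))%N; set d := (e %% m)%N.
have nE : (babs_order k m)%:Z = ((2 * k + 1) ^ m)%:Z * m%:Z by rewrite -PoszM.
have h0 (l : nat) : 0 \in centered_range k by rewrite mem_centered_range; lia.
have [p [pP pL /dvdzP[y]]] := babs_walk d s h0.
set u := last s p; rewrite big1 => [|j _]; last by rewrite mul0r.
rewrite mulr0 addr0 => hy.
have /dvdzP[x hx] : (m%:Z %| t%:Z - u%:Z)%Z.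
  apply/dvdzP.
  exists ((e %/ m)%N%:Z - ((2 * k + 1) ^ m)%:Z - y * ((2 * k + 1) ^ m)%:Z).
  have he : e%:Z = (e %/ m)%N%:Z * m%:Z + d%:Z by rewrite -PoszM -PoszD -divn_eq.
  have {}he : t%:Z + ((babs_order k m)%:Z - s%:Z) =
      (e %/ m)%N%:Z * m%:Z + d%:Z.
    by rewrite -he /e PoszD subzn // ltnW.
  rewrite nE in hy he; rewrite !mulrBl -(mulrA y) -hy.
  by rewrite -[X in X - _ - _](addrK d%:Z) -he; ring.
(* The [m] correcting hops advance by [m] on their own, which is one unit of the quotient [x]; the
   digits supply the other [x - 1]. *)
have [c [hc /dvdzP[z hz]]] := balanced_expansion k m (x - 1).
have [q [qP qL /dvdzP[w]]] := babs_walk m u hc.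
rewrite (sum_babs_level (fun l => c l * ((2 * k + 1) ^ l)%:Z)) //.
set S := \sum_(l < m) _ in hz *; set v := last u q => hw.
exists (p ++ q); rewrite cat_path pP qP last_cat size_cat pL qL.
rewrite eqxx andbT /= -/u -/v -val_eqE -eqz_nat /=.
have : (v%:Z == t%:Z %[mod babs_order k m])%Z.
  rewrite eqz_mod_dvd; apply/dvdzP; exists (w - z).
  rewrite mulrBl -hw nE mulrA -hz.
  have -> : t%:Z = x * m%:Z + u%:Z by rewrite -hx subrK.
  ring.
by rewrite !modz_nat !modn_small // andbT.
Qed.

(** The two arguments add up to [2 * n], so the sum of their remainders is a multiple of [m] below
    [2 * m]. *)
Lemma modn_sub_sym (m n s t : nat) :
  (0 < m)%N -> (m %| n)%N -> (s <= n)%N -> (t <= n)%N ->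
  ((t + (n - s)) %% m + (s + (n - t)) %% m <= m)%N.
Proof.
move=> m_gt0 m_dvd_n s_le t_le; set a := (t + (n - s))%N; set b := (s + (n - t))%N.
have ab_ltn : (a %% m + b %% m < m + m)%N.
  by rewrite -addnS leq_add ?ltn_pmod // ltnW ?ltn_pmod.
have : (m %| a %% m + b %% m)%N.
  rewrite /dvdn modnDm (_ : a + b = 2 * n)%N; last by rewrite /a /b; lia.
  exact: dvdn_mull.
by case/dvdnP=> [[|[|j]]] abE; move: ab_ltn; rewrite abE; lia.
Qed.

Lemma babs_route_length_sym (k m : nat) (s t : 'I_(babs_order k m)) :
  (0 < m)%N ->
  (babs_route_length k m s t + babs_route_length k m t s <= 3 * m)%N.
Proof.
move=> m_gt0; rewrite /babs_route_length.
have := modn_sub_sym m_gt0 (dvdn_mull _ (dvdnn m)) (ltnW (ltn_ord s))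
  (ltnW (ltn_ord t)).
rewrite -/(babs_order k m); lia.
Qed.

Theorem theorem4 (k m : nat) (hk : (1 <= k)%N) (hm : (1 <= m)%N) :
  exists r : 'I_(babs_order k m) -> 'I_(babs_order k m) -> seq 'I_(babs_order k m),
    [/\ routing_strategy (@babs_link k m) r,
        worst_case_hops r = (2 * m - 1)%N
      & average_hops r <= 3 / 2 * m%:R].
Proof.
set n := babs_order k m.
have m_le_n : (m <= n)%N by rewrite /n /babs_order leq_pmull // expn_gt0 addn1.
have n_gt0 := leq_trans hm m_le_n.
pose r s t := xchoose (babs_route (k := k) (m := m) s t hm).
have rP s t := xchooseP (babs_route (k := k) (m := m) s t hm).
have hopsE s t : hops r s t = babs_route_length k m s t.
  by have /and3P[_ _ /eqP] := rP s t.
exists r; split=> [s t||].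
- by have /and3P[pP /eqP lP _] := rP s t.
- apply/eqP; rewrite eqn_leq; apply/andP; split.
    apply/bigmax_leqP => s _; apply/bigmax_leqP => t _; rewrite hopsE.
    by have := ltn_pmod (t + (n - s)) hm; rewrite /babs_route_length -/n; lia.
  (* The maximum is attained from node 0 to node [m - 1], where the residue phase takes [m - 1]
     hops. *)
  have t_ltn : (m - 1 < n)%N by lia.
  apply: leq_trans (leq_bigmax (Ordinal n_gt0)).
  apply: leq_trans (leq_bigmax (Ordinal t_ltn)).
  rewrite hopsE /babs_route_length /= subn0 [(m - 1 + _)%N]addnC modnMDl.
  by rewrite modn_small; lia.
rewrite /average_hops card_ord -/n ler_pdivrMr ?ltr0n ?expn_gt0 ?n_gt0 //.
under eq_bigr do rewrite -natr_sum.
rewrite -natr_sum.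
set H := (\sum_s _)%N.
suff : (2 * H <= 3 * m * n ^ 2)%N.
  by rewrite -(ler_nat rat) !natrM; lra.
(* Adding the double sum to its transpose pairs each route with the reverse one, and each pair costs
   at most [3 * m]. *)
rewrite mul2n -addnn {2}/H exchange_big -big_split /=.
have -> : (3 * m * n ^ 2 = \sum_(s < n) \sum_(t < n) 3 * m)%N.
  by rewrite !sum_nat_const card_ord; lia.
apply: leq_sum => s _; rewrite -big_split; apply: leq_sum => t _ /=.
by rewrite !hopsE babs_route_length_sym.
Qed.
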